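(* Let $F=(F_1,\dots,F_m)$ be a Fractran program and let $\mathcal{A}_F$ be the Fractran-type canonical collection associated with $F$. Then $F$ halts for all inputs if and only if $\mathcal{A}_F$ is complete.
   Context: **Notation.** $\mathbb{N}_0=\{0,1,2,\dots\}$; for $n\in\mathbb{N}$, $[n]=\{0,1,\dots,n-1\}$. **Fractran.** A Fractran program is a finite (nonempty) sequence $F=(F_1,\dots,F_m)$ of positive rational numbers. Inputs are elements of $\mathbb{N}_0$; on the input $0$ the program halts immediately. A single Fractran iteration on $n\geqslant1$ replaces $n$ by $F_k n$, where $k$ is the least index such that $F_kn$ is an integer; if no such $k$ exists, the program halts at $n$. Executing the program on an input means repeating Fractran iterations while possible; the program halts on that input if this process terminates after finitely many iterations. Let $f_F\colon\mathbb{N}_0\to\mathbb{N}_0$ be the function that applies a single Fractran iteration to its input if this is possible, and returns $0$ otherwise (i.e. if the program immediately halts on that input; in particular $f_F(0)=0$). **Canonical collection.** Let $(b_i)_{i\in\mathbb{N}_0}$ be a sequence of integers with $b_i>1$ (the bases), and let $(T_i)_{i\in\mathbb{N}_0}$ be a sequence of subsets of $\mathbb{Z}$ such that each $T_i$ is a complete residue system modulo $b_i$ (it contains exactly one representative of each residue class) and $0\in T_i$. The canonical collection defined by $(b_i)$ and $(T_i)$ is $\{A_i\}_{i\in\mathbb{N}_0}$ with $A_i=b_0b_1\cdots b_{i-1}T_i$, where $kT=\{kt\mid t\in T\}$ and the empty product is $1$. It is called complete if it is an additive system for $\mathbb{Z}$, i.e. every $n\in\mathbb{Z}$ has exactly one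 representation $n=a_0+a_1+\cdots$ with $a_i\in A_i$ for all $i$ and all but finitely many $a_i$ equal to $0$. **Associated canonical system.** For $n\in\mathbb{Z}$ let $t_i(n)$ be the unique element of $T_i$ congruent to $n$ modulo $b_i$, and let $f_i(n)=\frac{1}{b_i}(n-t_i(n))$. Given the bases, the sets $T_i$ are determined by the values $f_i(r)$ for $r\in[b_i]$ via $T_i=\{r-b_if_i(r)\mid r\in[b_i]\}$; these values may be prescribed as arbitrary integers subject only to $f_i(0)=0$. **Fractran-type canonical collection $\mathcal{A}_F$.** Put $b=1+\left\lceil\max_{1\leqslant k\leqslant m}F_k\right\rceil$ and $b_i=b^{i+1}$ for $i\in\mathbb{N}_0$. The sets $T_i$ are determined via $T_i=\{r-b_if_i(r)\mid r\in[b_i]\}$ by setting $f_i(r)=f_F(r)$ for $r\in[b_i-1]=\{0,1,\dots,b_i-2\}$ and $f_i(b_i-1)=1$. $\mathcal{A}_F$ is the canonical collection defined by these $(b_i)$ and $(T_i)$. *)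

(* Defs.v *)
From mathcomp Require Export all_boot all_order all_algebra.
From mathcomp Require Export mathcomp_extra boolp classical_sets functions.
From mathcomp Require Export cardinality fsbigop.

Set Implicit Arguments.
Unset Strict Implicit.
Unset Printing Implicit Defensive.

Import Order.TTheory GRing.Theory Num.Theory.

Local Open Scope classical_set_scope.
Local Open Scope ring_scope.

Definition fractran_program (F : seq rat) : Prop :=
  F <> [::] /\ forall q, q \in F -> 0 < q.

(* One iteration; [None] means that the program halts immediately.  Since the
   fractions are positive, truncation of an integral [q * n%:R] loses nothing. *)
Definition fractran_step (F : seq rat) (n : nat) : option nat :=
  if n == 0%N then None
  else omap (fun q => Num.truncn (q * n%:R))
            (ohead [seq q <- F | q * n%:R \is a Num.int]).

(* Some number [k] of iterations cannot be completed starting from [n]. *)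
Definition fractran_halts (F : seq rat) (n : nat) : Prop :=
  exists k, iter k (obind (fractran_step F)) (Some n) = None.

Definition fractran_fun (F : seq rat) (n : nat) : nat :=
  odflt 0%N (fractran_step F n).

Definition complete_residue_system (b : int) (T : set int) : Prop :=
  forall n : int, exists! t : int, T t /\ (t = n %[mod b])%Z.

Definition canonical_data (b : nat -> int) (T : nat -> set int) : Prop :=
  forall i, [/\ 1 < b i, complete_residue_system (b i) (T i) & T i 0].

Definition canonical_collection (b : nat -> int) (T : nat -> set int)
  (i : nat) : set int := [set (\prod_(j < i) b j) * t | t in T i].

Definition representation (A : nat -> set int) (n : int) (a : nat -> int) :
  Prop :=
  [/\ forall i, A i (a i),
      finite_set [set i | a i != 0]
    & n = \sum_(i \in [set: nat]) a i].

Definition additive_system (A : nat -> set int) : Prop :=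
  forall n : int, exists! a : nat -> int, representation A n a.

(* The digit sets determined by prescribing [f_i(r)] for [0 <= r < b_i]. *)
Definition digits_of (b : nat -> int) (f : nat -> nat -> int) (i : nat) :
  set int := [set r%:Z - b i * f i r | r in [set r : nat | r%:Z < b i]].

(* As all fractions are positive, the default 0 does not affect the maximum. *)
Definition fractran_base (F : seq rat) : int :=
  1 + Num.ceil (\big[Num.max/0]_(q <- F) q).

Definition fractran_bases (F : seq rat) (i : nat) : int :=
  fractran_base F ^+ i.+1.

Definition fractran_values (F : seq rat) (i r : nat) : int :=
  if r%:Z == fractran_bases F i - 1 then 1 else (fractran_fun F r)%:Z.

Definition fractran_digits (F : seq rat) : nat -> set int :=
  digits_of (fractran_bases F) (fractran_values F).

Definition fractran_collection (F : seq rat) : nat -> set int :=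
  canonical_collection (fractran_bases F) (fractran_digits F).

Lemma digits_of_residues (b : nat -> int) (f : nat -> nat -> int) (i : nat) :
  1 < b i -> complete_residue_system (b i) (digits_of b f i).
Proof.
move=> b1 n; have b0 : 0 < b i by apply: lt_trans b1.
have bN0 : b i != 0 by rewrite gt_eqF.
have modr (r : nat) : r%:Z < b i -> ((r%:Z - b i * f i r) %% b i)%Z = r.
  by move=> rb; rewrite mulrC -mulNr addrC modzMDl modz_small ?rb.
have rE : (`|(n %% b i)%Z|%N)%:Z = (n %% b i)%Z.
  by rewrite gez0_abs ?modz_ge0.
exists (`|(n %% b i)%Z|%N%:Z - b i * f i `|(n %% b i)%Z|%N); split.
  split; first by exists `|(n %% b i)%Z|%N => //=; rewrite rE ltz_pmod.
  by rewrite modr rE ?ltz_pmod.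
by move=> _ [[r /= rb <-]]; rewrite modr // => <-; rewrite absz_nat.
Qed.

Lemma fractran_base_gt1 (F : seq rat) :
  fractran_program F -> 1 < fractran_base F.
Proof.
case=> F0 Fpos; rewrite /fractran_base ltrDl.
rewrite real_ceil_gt_int ?num_real //.
case: F F0 Fpos => // q F _ Fpos.
by rewrite big_cons lt_max Fpos ?mem_head.
Qed.

Lemma fractran_canonical_data (F : seq rat) : fractran_program F ->
  canonical_data (fractran_bases F) (fractran_digits F).
Proof.
move=> FP i; have b1 : 1 < fractran_bases F i.
  by rewrite exprn_egt1 ?fractran_base_gt1.
split=> //; first exact: digits_of_residues.
exists 0%N => /=; first by apply: lt_trans b1.
rewrite /fractran_values eq_sym subr_eq0 gt_eqF //=.
by rewrite /fractran_fun /fractran_step eqxx /= mulr0 subr0.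
Qed.

(* Main.v *)
Require Import Defs.
From mathcomp Require Import zify ring.

(** Replacing n by f_i(n) = (n - t_i(n)) / b_i at stage i strips the digits of
    n one by one, so the collection is complete iff the orbit of every integer
    reaches 0.  For A_F with b = c + 1, a negative value strictly increases at
    each stage, while a nonnegative one is multiplied by at most c < b; since
    b_i = b^(i+1), every orbit eventually stays in [0, b_i - 2], where f_i is
    the Fractran step f_F.  Conversely each Fractran run occurs as such a tail,
    because b_0 ... b_(i-1) n reaches n at stage i. *)

Set Implicit Arguments.
Unset Strict Implicit.
Unset Printing Implicit Defensive.

Import Order.TTheory GRing.Theory Num.Theory.

Local Open Scope classical_set_scope.
Local Open Scope ring_scope.

(** * Halting in terms of f_F, and linear growth of f_F *)

Lemma iter_fractran_fun (F : seq rat) (n k : nat) :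
  iter k (fractran_fun F) n =
  odflt 0%N (iter k (obind (fractran_step F)) (Some n)).
Proof.
elim: k => //= k ->.
by case: (iter _ _ _).
Qed.

Lemma fractran_haltsE (F : seq rat) (n : nat) :
  fractran_halts F n <-> exists k, iter k (fractran_fun F) n = 0%N.
Proof.
split=> [[k nk]|[k]]; first by exists k; rewrite iter_fractran_fun nk.
(* The extra iteration covers the case where the [k]-th one yields [Some 0], from which no step is
   possible. *)
rewrite iter_fractran_fun => nk; exists k.+1; move: nk => /=.
by case: (iter _ _ _) => //= _ ->.
Qed.

(** The c with base c + 1; for a program the ceiling is positive, so [absz] does not change it. *)
Definition fractran_slope (F : seq rat) : nat :=
  `|Num.ceil (\big[Num.max/0]_(q <- F) q)%R|%N.

Lemma fractran_baseE (F : seq rat) : fractran_program F ->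
  fractran_base F = (fractran_slope F).+1%:Z /\ (0 < fractran_slope F)%N.
Proof.
move=> /fractran_base_gt1; rewrite /fractran_base /fractran_slope.
by set z := Num.ceil _ => ?; lia.
Qed.

(** The applied fraction is at most the maximum, hence at most its ceiling; on halting the value is
    0. *)
Lemma fractran_fun_le (F : seq rat) (n : nat) : fractran_program F ->
  (fractran_fun F n <= fractran_slope F * n)%N.
Proof.
move=> FP; rewrite /fractran_fun /fractran_step.
case: eqP => //= _; case sE : [seq _ <- _ | _] => [|q s] //=.
have /[!mem_filter]/andP[_ qF] : q \in [seq q <- F | q * n%:R \is a Num.int].
  by rewrite sE mem_head.
rewrite -(ler_nat rat) natrM.
have q0 : 0 < q by case: FP => _ /(_ _ qF).
apply: (@le_trans _ _ (q * n%:R)); first by rewrite truncn_le mulr_ge0 // ltW.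
apply: ler_wpM2r => //.
have qm : q <= \big[Num.max/0]_(p <- F) p by exact: le_bigmax_seq.
apply: (le_trans qm); apply: le_trans (ceil_ge _) _.
by rewrite natr_absz ler_int ler_norm.
Qed.

(** * Canonical collections: finitely supported sums, orbits and digits *)

Lemma fsbig_nat_eq (a : nat -> int) (K : nat) :
  (forall i, (K <= i)%N -> a i = 0) ->
  \sum_(i \in [set: nat]) a i = \sum_(i < K) a i.
Proof.
move=> aK; rewrite fsbig_ord; apply/esym/fsbig_widen => // i [_ /= /negP].
by rewrite -leqNgt => /aK.
Qed.

Lemma finite_support_bound (a : nat -> int) :
  finite_set [set i | a i != 0] -> exists K, forall i, (K <= i)%N -> a i = 0.
Proof.
move=> /finite_seqP[s sE]; exists (\max_(i <- s) i).+1 => i Ki.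
apply/eqP/negPn/negP => ai.
have si : i \in s by have : [set` s] i by rewrite -sE.
have : (i <= \max_(j <- s) j)%N by exact: leq_bigmax_seq.
by rewrite leqNgt Ki.
Qed.

(** This is f_i(n): if n = q b_i + r with 0 <= r < b_i, then t_i(n) = r - b_i f_i(r), so (n -
    t_i(n)) / b_i = q + f_i(r). *)
Definition canonical_shift (b : nat -> int) (f : nat -> nat -> int) (i : nat)
  (n : int) : int := (n %/ b i)%Z + f i `|(n %% b i)%Z|%N.

Fixpoint canonical_orbit (b : nat -> int) (f : nat -> nat -> int) (i : nat)
  (n : int) : int :=
  if i is j.+1 then canonical_shift b f j (canonical_orbit b f j n) else n.

Section CanonicalOrbit.
Variables (b : nat -> int) (f : nat -> nat -> int).
Hypotheses (b_gt1 : forall i, 1 < b i) (f0 : forall i, f i 0 = 0).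

Local Notation shift := (canonical_shift b f).
Local Notation orb := (canonical_orbit b f).
Local Notation P k := (\prod_(j < k) b j).
(** Since m - b_i f_i(m) = t_i(m), this is b_0 ... b_(i-1) t_i(m) for m = [orb i n]. *)
Local Notation digit n i := (P i * (orb i n - b i * orb i.+1 n)).

Let b_neq0 i : b i != 0. Proof. by have := b_gt1 i; lia. Qed.

Let P_neq0 k : P k != 0.
Proof. by apply/prodf_neq0 => j _; exact: b_neq0. Qed.

Lemma canonical_shift_mull i n : shift i (b i * n) = n.
Proof. by rewrite /canonical_shift mulrC mulzK // modzMl f0 addr0. Qed.

Lemma canonical_shift0 i : shift i 0 = 0.
Proof. by rewrite -[X in shift _ X](mulr0 (b i)) canonical_shift_mull. Qed.

Lemma canonical_shift_digit i n : digits_of b f i (n - b i * shift i n).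
Proof.
have b0 : 0 < b i by have := b_gt1 i; lia.
exists `|(n %% b i)%Z|%N; first by rewrite /= gez0_abs ?modz_ge0 ?ltz_pmod.
rewrite /canonical_shift gez0_abs ?modz_ge0 //.
by rewrite [X in _ = X - _](divz_eq n (b i)); ring.
Qed.

Lemma canonical_shift_unique i n t :
  digits_of b f i t -> (b i %| n - t)%Z -> t = n - b i * shift i n.
Proof.
move=> tD; rewrite -eqz_mod_dvd => /eqP nt.
have [u [_ uU]] := digits_of_residues f (b_gt1 i) n.
rewrite -(uU t) // -(uU (n - b i * shift i n)) //; split.
  exact: canonical_shift_digit.
by rewrite addrC mulrC -mulNr modzMDl.
Qed.

Lemma canonical_orbit_eventually0 n k j :
  orb k n = 0 -> (k <= j)%N -> orb j n = 0.
Proof.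
move=> nk /subnK <-; elim: (j - k)%N => //= l IH.
by rewrite IH canonical_shift0.
Qed.

(** Makes any integer appear at any chosen stage: multiples of b_j have digit 0, so each shift just
    divides. *)
Lemma canonical_orbit_lift k n : orb k (P k * n) = n.
Proof.
elim: k n => [|k IH] n; first by rewrite big_ord0 mul1r.
by rewrite big_ord_recr /= -mulrA IH canonical_shift_mull.
Qed.

(** The digits telescope: [digit n i] is [P i * orb i n] minus the same term at i + 1. *)
Lemma sum_canonical_digits n k : n = \sum_(i < k) digit n i + P k * orb k n.
Proof.
elim: k => [|k IH]; first by rewrite !big_ord0 mul1r add0r.
by rewrite !big_ord_recr /= {1}IH; ring.
Qed.

Lemma canonical_representation n k : orb k n = 0 ->
  representation (canonical_collection b (digits_of b f)) n
    (fun i => digit n i).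
Proof.
move=> nk; have dk i : (k <= i)%N -> digit n i = 0.
  move=> ki; rewrite !(canonical_orbit_eventually0 nk) ?(leqW ki) //.
  by rewrite mulr0 subr0 mulr0.
split.
- move=> i; exists (orb i n - b i * orb i.+1 n) => //.
  exact: canonical_shift_digit.
- apply: sub_finite_set (finite_II k) => i /= ; apply: contraNltn => ki.
  by rewrite dk.
- by rewrite (fsbig_nat_eq dk) {1}(sum_canonical_digits n k) nk mulr0 addr0.
Qed.

(** Digits are forced from the lowest up: all terms after the k-th are divisible by [P k.+1], which
    fixes the residue of the k-th one modulo b_k. *)
Lemma representation_digit n a :
  representation (canonical_collection b (digits_of b f)) n a ->
  (forall i, a i = digit n i) /\ exists k, orb k n = 0.
Proof.
move=> [aA /finite_support_bound[K aK] nE].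
have nS k : (K <= k)%N -> n = \sum_(i < k) a i.
  by move=> Kk; rewrite nE; apply: fsbig_nat_eq => i /(leq_trans Kk)/aK.
have a_dvd k j : (k <= j)%N -> (P k %| a j)%Z.
  move=> kj; have [t _ <-] := aA j; apply: dvdz_mulr.
  rewrite -!(big_mkord xpredT b) (big_cat_nat (n := k)) //=.
  exact: dvdz_mulr.
have aE k : a k = digit n k.
  elim/ltn_ind: k => k IH.
  have [t tD tE] := aA k; rewrite -tE; congr (_ * _).
  apply: canonical_shift_unique => //.
  rewrite -(dvdz_mul2l (p := P k)) //.
  (* Cancelling the first k terms leaves the tail after [a k]; the upper bound covers the support
     and the index k itself. *)
  have -> : P k * (orb k n - t) = \sum_(k.+1 <= i < maxn K k.+1) a i.
    have : n = \sum_(i < k) a i + P k * orb k n.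
      rewrite {1}(sum_canonical_digits n k); congr (_ + _).
      by apply: eq_bigr => i _; rewrite IH.
    rewrite {1}(nS (maxn K k.+1)) ?leq_maxl // -!(big_mkord xpredT a).
    rewrite (big_cat_nat (n := k.+1)) ?leq_maxr //= big_nat_recr //= -tE.
    by rewrite -addrA => /addrI nk; rewrite mulrBr -nk [LHS]addrC addKr.
  have -> : P k * b k = P k.+1 by rewrite big_ord_recr.
  rewrite big_nat; elim/big_ind: _ => [|x y|i /andP[ki _]]; last exact: a_dvd.
  - exact: dvdz0.
  - exact: rpredD.
(* Beyond the support the digits already sum to n, so the remainder [P K * orb K n] vanishes. *)
split=> //; exists K; apply: (mulfI (P_neq0 K)); rewrite mulr0.
have := sum_canonical_digits n K; rewrite {1}(nS K) //.
under eq_bigr do rewrite aE.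
by rewrite -[LHS]addr0 => /addrI.
Qed.

Lemma additive_system_canonical_orbit :
  additive_system (canonical_collection b (digits_of b f)) <->
  forall n, exists k, orb k n = 0.
Proof.
split=> [AS n|orb0 n].
  by have [a [/representation_digit[]]] := AS n.
have [k nk] := orb0 n; exists (fun i => digit n i); split.
  exact: canonical_representation nk.
by move=> a /representation_digit[aE _]; apply/funext => i; rewrite aE.
Qed.

End CanonicalOrbit.

(** * Growth of the orbits of A_F compared with the bases *)

Lemma Bernoulli_expn (d x : nat) : (0 < d)%N ->
  (d ^ (d * x) * x.+1 <= d.+1 ^ (d * x))%N.
Proof.
move=> d0; rewrite -(leq_pmul2l d0).
(* Bernoulli's inequality (1 + 1/d)^m >= 1 + m/d with denominators cleared, to be used at m = d
   x. *)
suff H m : (d ^ m * (d + m) <= d * d.+1 ^ m)%N.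
  by apply: leq_trans (H _); rewrite mulnCA mulnS.
elim: m => [|m IH]; first by rewrite !expn0; lia.
rewrite !expnS; have : (d ^ m * (d * (d + m.+1)) <= d ^ m * (d.+1 * (d + m)))%N.
  by rewrite leq_mul2l; apply/orP; right; nia.
nia.
Qed.

Section FractranCollection.
Variable F : seq rat.
Hypothesis FP : fractran_program F.

Local Notation c := (fractran_slope F).
Local Notation g := (fractran_fun F).
Local Notation base := (fractran_bases F).
Local Notation val := (fractran_values F).
Local Notation shift := (canonical_shift base val).
Local Notation orb := (canonical_orbit base val).

Let c_gt0 : (0 < c)%N. Proof. by have [] := fractran_baseE FP. Qed.

Let base_gt1 i : 1 < base i.
Proof. by have [] := fractran_canonical_data FP i. Qed.

Let g_le n : (g n <= c * n)%N. Proof. exact: fractran_fun_le. Qed.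

Lemma fractran_basesE i : base i = (c.+1 ^ i.+1)%N%:Z.
Proof. by rewrite /fractran_bases (fractran_baseE FP).1 -rmorphXn. Qed.

Lemma fractran_values0 i : val i 0 = 0.
Proof.
have := g_le 0; rewrite muln0 leqn0 => /eqP g0.
by rewrite /fractran_values g0 ifF //; have := base_gt1 i; lia.
Qed.

Lemma fractran_values_bound i r : 0 <= val i r <= (c * r)%N%:Z.
Proof.
rewrite /fractran_values; case: eqP => [rb|_]; last by have := g_le r; lia.
have := base_gt1 i; have : (r <= c * r)%N by exact: leq_pmull.
lia.
Qed.

Lemma fractran_shift_nat i (x : nat) :
  exists2 y : nat, shift i x%:Z = y%:Z & (y <= c * x)%N.
Proof.
have b1 := base_gt1 i.
have := fractran_values_bound i `|(x%:Z %% base i)%Z|%N.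
rewrite /canonical_shift; set v := val _ _ => /andP[v0 vr].
have xE := divz_eq x%:Z (base i).
have r0 : 0 <= (x %% base i)%Z by rewrite modz_ge0 //; lia.
have q0 : 0 <= (x %/ base i)%Z by rewrite divz_ge0 //; lia.
exists `|((x %/ base i)%Z + v)%R|%N; first by lia.
suff : (x %/ base i)%Z + v <= c%:Z * x by lia.
rewrite [X in _ <= _ * X]xE mulrDr lerD //; last by lia.
have : 0 <= (x %/ base i)%Z * (c%:Z * base i - 1).
  (* As c b_i >= 1, the quotient q is at most c q b_i. *)
  by apply: mulr_ge0 => //; nia.
nia.
Qed.

Lemma fractran_shift_lt0 i (n : int) : n < 0 -> n < shift i n.
Proof.
move=> n0; have b1 := base_gt1 i; have nE := divz_eq n (base i).
have rb : (n %% base i)%Z < base i by rewrite ltz_pmod //; lia.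
have r0 : 0 <= (n %% base i)%Z by rewrite modz_ge0 //; lia.
have := fractran_values_bound i `|(n %% base i)%Z|%N => /andP[v0 _].
have [q1|q1|q1] := ltgtP (n %/ base i)%Z (-1).
- apply: (@lt_le_trans _ _ (n %/ base i)%Z); last by rewrite lerDl.
  move: (n %/ base i)%Z (n %% base i)%Z nE rb {r0 v0} q1 => q r nE rb q1.
  by nia.
- have : 0 <= (n %/ base i)%Z * base i by apply: mulr_ge0; lia.
  by lia.
have rE : (n %% base i)%Z = n + base i by lia.
(* With quotient -1 the shift is at least -1. Only n = -1 could be fixed; its residue is b_i - 1,
   and the prescribed value 1 there sends it to 0. *)
rewrite /canonical_shift q1; have [n1|] := eqVneq n (-1); last by lia.
by rewrite /fractran_values rE n1 ifT //; apply/eqP; lia.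
Qed.

Lemma fractran_shift_small i (x : nat) : (x.+1 < c.+1 ^ i.+1)%N ->
  shift i x%:Z = (g x)%:Z.
Proof.
move=> xb; have xb' : x.+1%:Z < base i by rewrite fractran_basesE; lia.
rewrite /canonical_shift divz_small ?modz_small; try lia.
by rewrite add0r /fractran_values ifF //; lia.
Qed.

(** The bound persists: each stage multiplies x + 1 by at most c + 1 and the base by exactly c + 1.
    It also keeps x away from the exceptional residue b_i - 1. *)
Lemma fractran_orbit_small i (x : nat) (n : int) k :
  orb i n = x%:Z -> (x.+1 < c.+1 ^ i.+1)%N ->
  orb (k + i)%N n = (iter k g x)%:Z.
Proof.
move=> nx xb; suff [] : orb (k + i)%N n = (iter k g x)%:Z /\
  ((iter k g x).+1 < c.+1 ^ (k + i).+1)%N by [].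
elim: k => [//|k [IH IHb]] /=; rewrite IH fractran_shift_small //; split=> //.
apply: leq_ltn_trans (_ : c.+1 * (iter k g x).+1 < _)%N.
  by have := g_le (iter k g x); nia.
by rewrite [ltnRHS]expnS ltn_pmul2l.
Qed.

Lemma fractran_orbit_nat i j (x : nat) (n : int) : orb i n = x%:Z ->
  exists2 y : nat, orb (j + i)%N n = y%:Z & (y <= c ^ j * x)%N.
Proof.
move=> nx; elim: j => [|j [y yE ylt]]; first by exists x => //; rewrite mul1n.
have [z zE zlt] := fractran_shift_nat (j + i) y.
exists z; first by rewrite /= yE.
by rewrite expnS -mulnA (leq_trans zlt) // leq_mul2l ylt orbT.
Qed.

Lemma fractran_orbit_ge0 n : exists i (x : nat), orb i n = x%:Z.
Proof.
suff [i oi] : exists i, 0 <= orb i n.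
  by exists i, `|orb i n|%N; rewrite gez0_abs.
(* A negative orbit gains at least 1 per stage, so a gain of |n| suffices. *)
suff /(_ `|n|%N)[i] : forall m, exists i,
    - `|n| + m%:Z <= orb i n \/ 0 <= orb i n.
  by move=> [|] H; exists i => //; lia.
elim=> [|m [i IH]]; first by exists 0%N; left=> /=; lia.
have [i0|i0] := leP 0 (orb i n); first by exists i; right.
exists i.+1; left => /=; have := fractran_shift_lt0 i i0.
by case: IH; lia.
Qed.

Lemma fractran_orbit_eventually_small n :
  exists i (x : nat), orb i n = x%:Z /\ (x.+1 < c.+1 ^ i.+1)%N.
Proof.
have [i [x nx]] := fractran_orbit_ge0 n.
(* After c x further stages Bernoulli gives c^(c x) (x + 1) <= (c + 1)^(c x), which outweighs the
   factor x. *)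
have [y yE ylt] := fractran_orbit_nat (c * x) nx.
exists (c * x + i)%N, y; split=> //.
have c1 : (0 < c ^ (c * x))%N by rewrite expn_gt0 c_gt0.
have : (c.+1 ^ (c * x).+1 <= c.+1 ^ (c * x + i).+1)%N.
  by rewrite leq_exp2l; lia.
have := Bernoulli_expn x c_gt0; rewrite expnS; nia.
Qed.

End FractranCollection.

Theorem theorem2 (F : seq rat) (hF : fractran_program F) :
  (forall n : nat, fractran_halts F n) <->
  additive_system (fractran_collection F).
Proof.
have b1 i : 1 < fractran_bases F i by have [] := fractran_canonical_data hF i.
have v0 := fractran_values0 hF.
rewrite additive_system_canonical_orbit //; split=> [halts n|orb0 n].
  have [i [x [nx xb]]] := fractran_orbit_eventually_small hF n.
  have /fractran_haltsE[k xk] := halts x.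
  by exists (k + i)%N; rewrite (fractran_orbit_small hF _ nx xb) xk.
(* Stage n is late enough for the input n, so the lift [m] reaches n where the shift is already
   f_F. *)
have nb : (n.+1 < (fractran_slope F).+1 ^ n.+1)%N.
  by apply: ltn_expl; have [] := fractran_baseE hF.
pose m := \prod_(j < n) fractran_bases F j * n%:Z.
have mn := canonical_orbit_lift b1 v0 n n%:Z.
have [k mk] := orb0 m; apply/fractran_haltsE; exists k.
have := fractran_orbit_small hF k mn nb.
(* Zero is absorbing, so the orbit vanishes at stage k + n, where it equals the k-th iterate of f_F
   on n. *)
by rewrite (canonical_orbit_eventually0 b1 v0 mk) ?leq_addr // => -[].
Qed.
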